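(* There exist an integer $M>1$ that is a perfect square with $M\equiv 1\pmod{24}$, and positive integers $a,s$, such that $\sum_{i=0}^{M-1}(a+i)^2=s^2$. Furthermore, if $M>1$ is a perfect square for which there exist positive integers $a,s$ with $\sum_{i=0}^{M-1}(a+i)^2=s^2$, then $M\equiv 1\pmod{24}$ and there is $n\in\mathbb{Z}$ with $M=(6n-1)^2$; equivalently, $(M-1)/24=n(3n-1)/2$ is a generalized pentagonal number.
   Context: A generalized pentagonal number is an integer of the form $n(3n-1)/2$ with $n\in\mathbb{Z}$. *)

(* Defs.v *)
From mathcomp Require Import all_boot all_order all_algebra.
From mathcomp Require Import ring.

Set Implicit Arguments.
Unset Strict Implicit.
Unset Printing Implicit Defensive.

Import Order.TTheory GRing.Theory Num.Theory.

Definition perfect_square (M : nat) : Prop := exists m : nat, M = (m ^ 2)%N.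

(* The integer division is exact, see [dvd2_pentagonal]. *)
Definition pentagonal (n : int) : int := ((n * (3 * n - 1))%R %/ 2)%Z.

Definition generalized_pentagonal (k : int) : Prop :=
  exists n : int, k = pentagonal n.

Lemma dvd2_pentagonal (n : int) : (pentagonal n * 2 = n * (3 * n - 1))%R.
Proof.
rewrite /pentagonal divzK //.
have -> : (n * (3 * n - 1) = n * (n - 1) + (n * n) * 2)%R by ring.
rewrite rpredD //; last exact: dvdz_mull.
have dvd2 (m : nat) : (2 %| (m%:Z * (m%:Z - 1))%R)%Z.
  case: m => [|m]; first by rewrite mul0r.
  have -> : (m.+1%:Z * (m.+1%:Z - 1) = (m.+1 * m)%N%:Z)%R.
    by rewrite -[m.+1]addn1 !PoszM PoszD addrK.
  by rewrite dvdzE /= dvdn2 oddM /= andNb.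
case: n => m; first exact: dvd2.
have -> : (Negz m * (Negz m - 1) = m.+2%:Z * (m.+2%:Z - 1))%R.
  rewrite NegzE -[m.+2]addn1 -[m.+1]addn1 !PoszD; ring.
exact: dvd2.
Qed.

(* Main.v *)
Require Import Defs.
From mathcomp Require Import all_boot all_order all_algebra.
From mathcomp Require Import ring zify.
Import Order.TTheory GRing.Theory Num.Theory.

(** For existence, [M = 49], [a = 25] and [s = 357] work: dividing the sum by
    [49] leaves [(a + 24) ^ 2 + 200 = t ^ 2] with [s = 7 * t], and the
    factorisation [200 = 2 * 100] gives [t = 51], [a + 24 = 49].

    For necessity, let [M = m ^ 2]. Summing the squares in closed form gives
    [6 * s ^ 2 = m ^ 2 * K] with
    [K = 6 * (a ^ 2 + a * (M - 1)) + (M - 1) * (2 * M - 1)]. Let [p] be [2] or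
    [3]. The [p]-adic valuation of the left-hand side is odd and that of
    [m ^ 2] is even, so [p] divides [K] ([dvdn_square_cofactor]). But if [p]
    also divided [m], then [K] would be [1] modulo [p]. Hence [m] is prime to
    [6], i.e. [m = 6 * n - 1] for some integer [n], up to the sign of [m]; and
    [(6 * n - 1) ^ 2 = 24 * pentagonal n + 1] turns this into the congruence
    modulo [24] and the pentagonal form of [(M - 1) / 24]. *)

Lemma sum_consecutive_squares (a N : nat) :
  (6 * (\sum_(0 <= i < N.+1) (a + i) ^ 2) =
     N.+1 * (6 * (a ^ 2 + a * N) + N * (2 * N + 1)))%N.
Proof.
elim: N => [|N IHN]; first by rewrite big_nat1; ring.
by rewrite big_nat_recr //= mulnDr IHN -[N.+2]addn2 -[N.+1]addn1; ring.
Qed.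

Lemma odd_logn_prime_dvdn (p n : nat) :
  odd (logn p n) -> prime p /\ (p %| n)%N.
Proof.
move=> odd_n; have : (0 < logn p n)%N by case: logn odd_n.
by rewrite logn_gt0 mem_primes => /and3P[].
Qed.

(** The [p]-adic valuation of [c * s ^ 2] is odd and that of [m ^ 2] is even,
    so the valuation of [K] is odd, hence nonzero. *)
Lemma dvdn_square_cofactor (p c s m K : nat) :
  odd (logn p c) -> (0 < s)%N -> (c * s ^ 2 = m ^ 2 * K)%N -> (p %| K)%N.
Proof.
move=> odd_c s_gt0 eq_cs.
have c_gt0 : (0 < c)%N by case: c odd_c {eq_cs} => //; rewrite logn0.
have : (0 < m ^ 2 * K)%N by rewrite -eq_cs muln_gt0 c_gt0 expn_gt0 s_gt0.
rewrite muln_gt0 => /andP[m2_gt0 K_gt0].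
have odd_K : odd (logn p K).
  have := congr1 (odd \o logn p) eq_cs.
  rewrite /= (lognM _ c_gt0) ?expn_gt0 ?s_gt0 // (lognM _ m2_gt0) //.
  by rewrite !lognX oddD odd_c (oddM 2) oddD (oddM 2) /= => <-.
by have [] := odd_logn_prime_dvdn p K odd_K.
Qed.

Lemma square_sum_length_not_dvdn (p m a s : nat) :
  odd (logn p 6) -> (0 < s)%N ->
  (\sum_(0 <= i < m ^ 2) (a + i) ^ 2 = s ^ 2)%N -> ~~ (p %| m)%N.
Proof.
move=> odd_p s_gt0 sum_s; apply/negP => p_dvdm.
have [p_pr p_dvd6] := odd_logn_prime_dvdn p 6 odd_p.
have p_dvdm2 : (p %| m ^ 2)%N by rewrite dvdn_exp.
case def_m2: (m ^ 2)%N sum_s p_dvdm2 => [|N] sum_s p_dvdM.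
  by move: s_gt0; rewrite big_geq // in sum_s; case: s sum_s.
have := sum_consecutive_squares a N; rewrite sum_s -def_m2.
move=> /(dvdn_square_cofactor _ _ _ _ _ odd_p s_gt0).
rewrite dvdn_addr; last exact: dvdn_mulr.
(* Modulo N + 1 the remaining term is 1. *)
rewrite -(dvdn_addl _ p_dvdM).
have -> : (N * (2 * N + 1) + N.+1 = N.+1 * (2 * N) + 1)%N.
  by rewrite -[N.+1]addn1; ring.
by rewrite dvdn_addr ?dvdn_mulr // dvdn1 gtn_eqF ?prime_gt1.
Qed.

(** The residues [1] and [5] modulo [6] are exchanged by [m -> - m], which
    is why a single form [6 * n - 1] suffices for the square. *)
Lemma square_coprime6 (m : nat) :
  ~~ (2 %| m)%N -> ~~ (3 %| m)%N ->
  exists n : int, ((m ^ 2)%N%:Z = (6 * n - 1) ^+ 2)%R.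
Proof.
move=> m2 m3.
have [q [] ->] : exists q, m = (6 * q + 1)%N \/ m = (6 * q + 5)%N.
- by exists (m %/ 6)%N; lia.
- by exists (- q%:Z)%R; rewrite -mulnn !(PoszM, PoszD); ring.
- by exists (q%:Z + 1)%R; rewrite -mulnn !(PoszM, PoszD); ring.
Qed.

Lemma square_pentagonal (n : int) :
  ((6 * n - 1) ^+ 2 = pentagonal n * 24 + 1)%R.
Proof.
have -> : (pentagonal n * 24 = 12 * (pentagonal n * 2))%R by ring.
by rewrite dvd2_pentagonal; ring.
Qed.

Theorem theorem6 :
  (exists M : nat, (1 < M)%N /\ perfect_square M /\ M = 1 %[mod 24] /\
     exists a s : nat, (0 < a)%N /\ (0 < s)%N /\
       (\sum_(0 <= i < M) (a + i) ^ 2 = s ^ 2)%N) /\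
  (forall M : nat, (1 < M)%N -> perfect_square M ->
     (exists a s : nat, (0 < a)%N /\ (0 < s)%N /\
       (\sum_(0 <= i < M) (a + i) ^ 2 = s ^ 2)%N) ->
     M = 1 %[mod 24] /\
     (exists n : int, (M%:Z = (6 * n - 1) ^+ 2)%R) /\
     (forall n : int, (M%:Z = (6 * n - 1) ^+ 2)%R <->
        ((M%:Z - 1)%R %/ 24)%Z = pentagonal n) /\
     generalized_pentagonal ((M%:Z - 1)%R %/ 24)%Z).
Proof.
split.
  exists 49%N; split=> //; split; first by exists 7%N.
  split=> //; exists 25%N, 357%N; split=> //; split=> //.
  by have := sum_consecutive_squares 25 48; lia.
move=> _ _ [m ->] [a [s [_ [s_gt0 sum_s]]]].
have m2 := square_sum_length_not_dvdn 2 m a s isT s_gt0 sum_s.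
have m3 := square_sum_length_not_dvdn 3 m a s isT s_gt0 sum_s.
have [n def_M] := square_coprime6 m m2 m3.
have quotE : (((m ^ 2)%N%:Z - 1)%R %/ 24)%Z = pentagonal n.
  by rewrite def_M square_pentagonal addrK mulzK.
split.
  have M_pent : ((m ^ 2)%N%:Z = pentagonal n * 24 + 1)%R.
    by rewrite def_M square_pentagonal.
  by move: M_pent; move: (m ^ 2)%N (pentagonal n) => M k; lia.
split; first by exists n.
split; last by exists n.
move=> k; split=> [-> | ]; first by rewrite square_pentagonal addrK mulzK.
by rewrite quotE def_M !square_pentagonal => ->.
Qed.
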